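(* Let $\lambda_1,\lambda_2>0$. If $f_1\in\mathcal B_{\lambda_1}$ and $f_2\in\mathcal B_{\lambda_2}$, then the product $f_1f_2$ belongs to $\mathcal B_{\lambda_1+\lambda_2}$.
   Context: A function $g:(0,\infty)\to\mathbb R$ is completely monotonic if it is infinitely often differentiable and $(-1)^n g^{(n)}(x)\ge 0$ for all $n=0,1,2,\ldots$ and all $x>0$. For $\lambda>0$, a $C^\infty$-function $f:(0,\infty)\to(0,\infty)$ belongs to the class $\mathcal B_\lambda$ of generalized Bernstein functions of order $\lambda$ if $x\mapsto x^{1-\lambda}f'(x)$ is completely monotonic. *)

(* Defs.v *)
From Stdlib Require Import Reals.
From Coquelicot Require Import Coquelicot.
Open Scope R_scope.

(** Functions on (0, oo) are represented by total functions [R -> R] whose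
    values outside (0, oo) are irrelevant: since (0, oo) is open, the iterated
    derivatives at a point [x > 0] depend only on the values on (0, oo). *)

Definition smooth_on_positives (f : R -> R) : Prop :=
  forall (n : nat) (x : R), 0 < x -> ex_derive_n f n x.

Definition completely_monotonic (g : R -> R) : Prop :=
  smooth_on_positives g /\
  forall (n : nat) (x : R), 0 < x -> 0 <= (-1) ^ n * Derive_n g n x.

Definition gen_bernstein (lambda : R) (f : R -> R) : Prop :=
  smooth_on_positives f /\
  (forall x : R, 0 < x -> 0 < f x) /\
  completely_monotonic (fun x => Rpower x (1 - lambda) * Derive f x).

(* Main.v *)
Require Import Defs.
From Stdlib Require Import Reals.
From Coquelicot Require Import Coquelicot.
From Stdlib Require Import Lra Lia.
Open Scope R_scope.

(** For [x > 0],
<<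
  x^(1-a-b) (f1 f2)' = (x^(1-a) f1') (x^(-b) f2) + (x^(-a) f1) (x^(1-b) f2'),
>>
    where [a], [b] are the two orders.  Complete monotonicity is stable under
    sums and, by the Leibniz rule, under products, so everything rests on one
    fact: if [f] is a generalized Bernstein function of order [l > 0], then
    [h = x^(-l) f] is completely monotonic.

    The classical reason is the formula
    [h(x) = f(0+) x^(-l) + int_0^1 s^(l-1) g(x s) ds] with [g = x^(1-l) f'].
    The proof below avoids integrals.  The function [h] solves the Euler
    equation [x h' + l h = g], and differentiating [n] times gives
    [x h^(n+1) + (n+l) h^(n) = g^(n)].  Consequently
    [u_n = (-1)^n x^(n+l) h^(n)] has the derivative
    [(-1)^n x^(n+l-1) g^(n) >= 0], so that each [u_n] is nondecreasing, and
    moreover [x u_n' = (n+l) u_n - u_(n+1)].  Nonnegativity of [u_n] passes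
    to [u_(n+1)]: if [u_(n+1)] were equal to [-c < 0] somewhere, it would be at
    most [-c] all the way down to 0, whence [u_n' >= c/x] near 0, and [u_n]
    would tend to minus infinity there ([nonneg_of_euler_relation]).  The
    induction starts with [u_0 = f > 0]. *)

(** * Towers of derivatives *)

(** Exhibiting all derivatives of a function at once serves to establish
    smoothness and the values of [Derive_n] simultaneously. *)
Definition derivative_tower (F : nat -> R -> R) : Prop :=
  forall (n : nat) (x : R), 0 < x -> is_derive (F n) x (F (S n) x).

Lemma locally_positive (P : R -> Prop) (x : R) :
  0 < x -> (forall y, 0 < y -> P y) -> locally x P.
Proof.
  intros Hx HP.
  exact (filter_imp _ _ HP (open_gt 0 x Hx)).
Qed.

Lemma smooth_tower (f : R -> R) :
  smooth_on_positives f -> derivative_tower (Derive_n f).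
Proof.
  intros Hf n x Hx.
  apply Derive_correct.
  exact (Hf (S n) x Hx).
Qed.

Lemma smooth_is_derive (f : R -> R) (x : R) :
  smooth_on_positives f -> 0 < x -> is_derive f x (Derive f x).
Proof.
  intros Hf Hx.
  exact (smooth_tower f Hf 0%nat x Hx).
Qed.

Lemma Derive_n_tower (f : R -> R) (F : nat -> R -> R) :
  derivative_tower F -> (forall x, 0 < x -> f x = F 0%nat x) ->
  forall n x, 0 < x -> Derive_n f n x = F n x.
Proof.
  intros HF Hf n.
  induction n as [|n IH]; intros x Hx; [exact (Hf x Hx)|].
  simpl.
  rewrite (Derive_ext_loc _ (F n)) by exact (locally_positive _ x Hx IH).
  apply is_derive_unique.
  exact (HF n x Hx).
Qed.

Lemma smooth_of_tower (f : R -> R) (F : nat -> R -> R) :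
  derivative_tower F -> (forall x, 0 < x -> f x = F 0%nat x) ->
  smooth_on_positives f.
Proof.
  intros HF Hf [|n] x Hx; [exact I|].
  simpl.
  apply (ex_derive_ext_loc (F n)).
  - apply locally_positive; [exact Hx|].
    intros y Hy. symmetry. exact (Derive_n_tower f F HF Hf n y Hy).
  - exists (F (S n) x). exact (HF n x Hx).
Qed.

Lemma completely_monotonic_of_tower (f : R -> R) (F : nat -> R -> R) :
  derivative_tower F -> (forall x, 0 < x -> f x = F 0%nat x) ->
  (forall n x, 0 < x -> 0 <= (-1) ^ n * F n x) ->
  completely_monotonic f.
Proof.
  intros HF Hf Hsign.
  split; [exact (smooth_of_tower f F HF Hf)|].
  intros n x Hx.
  rewrite (Derive_n_tower f F HF Hf n x Hx).
  exact (Hsign n x Hx).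
Qed.

(** * Sums and products *)

Lemma completely_monotonic_ext (f g : R -> R) :
  (forall x, 0 < x -> f x = g x) ->
  completely_monotonic g -> completely_monotonic f.
Proof.
  intros Hfg [Hg Hsign].
  exact (completely_monotonic_of_tower f _ (smooth_tower g Hg) Hfg Hsign).
Qed.

Lemma completely_monotonic_plus (f g : R -> R) :
  completely_monotonic f -> completely_monotonic g ->
  completely_monotonic (fun x => f x + g x).
Proof.
  intros [Hf Sf] [Hg Sg].
  apply completely_monotonic_of_tower
    with (F := fun n x => Derive_n f n x + Derive_n g n x).
  - intros n x Hx.
    apply (is_derive_plus (Derive_n f n) (Derive_n g n)).
    + exact (smooth_tower f Hf n x Hx).
    + exact (smooth_tower g Hg n x Hx).
  - reflexivity.
  - intros n x Hx.
    rewrite Rmult_plus_distr_l.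
    apply Rplus_le_le_0_compat; [exact (Sf n x Hx)|exact (Sg n x Hx)].
Qed.

(** The [n]-th derivative of [F i * G j] for two towers.  Collecting equal
    terms would give the binomial form of the Leibniz rule; letting both
    indices vary makes every property a direct induction on [n] instead. *)
Fixpoint leibniz (F G : nat -> R -> R) (n i j : nat) (x : R) : R :=
  match n with
  | O => F i x * G j x
  | S m => leibniz F G m (S i) j x + leibniz F G m i (S j) x
  end.

Lemma leibniz_tower (F G : nat -> R -> R) (i j : nat) :
  derivative_tower F -> derivative_tower G ->
  derivative_tower (fun n => leibniz F G n i j).
Proof.
  intros HF HG n.
  revert i j.
  induction n as [|n IH]; intros i j x Hx.
  - apply (is_derive_mult (F i) (G j)).
    + exact (HF i x Hx).
    + exact (HG j x Hx).
    + exact Rmult_comm.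
  - apply (is_derive_plus (leibniz F G n (S i) j) (leibniz F G n i (S j))).
    + exact (IH (S i) j x Hx).
    + exact (IH i (S j) x Hx).
Qed.

Lemma leibniz_sign (F G : nat -> R -> R) (x : R) :
  (forall n, 0 <= (-1) ^ n * F n x) -> (forall n, 0 <= (-1) ^ n * G n x) ->
  forall n i j, 0 <= (-1) ^ (n + i + j) * leibniz F G n i j x.
Proof.
  intros SF SG n.
  induction n as [|n IH]; intros i j; simpl leibniz.
  - replace ((-1) ^ (0 + i + j) * (F i x * G j x))
      with (((-1) ^ i * F i x) * ((-1) ^ j * G j x))
      by (simpl; rewrite pow_add; ring).
    apply Rmult_le_pos; [exact (SF i)|exact (SG j)].
  - rewrite Rmult_plus_distr_l.
    apply Rplus_le_le_0_compat.
    + replace (S n + i + j)%nat with (n + S i + j)%nat by lia. apply IH.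
    + replace (S n + i + j)%nat with (n + i + S j)%nat by lia. apply IH.
Qed.

Lemma smooth_mult (f g : R -> R) :
  smooth_on_positives f -> smooth_on_positives g ->
  smooth_on_positives (fun x => f x * g x).
Proof.
  intros Hf Hg.
  apply smooth_of_tower
    with (F := fun n => leibniz (Derive_n f) (Derive_n g) n 0 0).
  - apply leibniz_tower; apply smooth_tower; assumption.
  - reflexivity.
Qed.

Lemma completely_monotonic_mult (f g : R -> R) :
  completely_monotonic f -> completely_monotonic g ->
  completely_monotonic (fun x => f x * g x).
Proof.
  intros [Hf Sf] [Hg Sg].
  apply completely_monotonic_of_tower
    with (F := fun n => leibniz (Derive_n f) (Derive_n g) n 0 0).
  - apply leibniz_tower; apply smooth_tower; assumption.
  - reflexivity.
  - intros n x Hx.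
    replace n with (n + 0 + 0)%nat at 1 by lia.
    apply leibniz_sign; intros k; [exact (Sf k x Hx)|exact (Sg k x Hx)].
Qed.

(** * Behaviour at the origin *)

Lemma nondecreasing_of_derive_nonneg (f df : R -> R) (a b : R) :
  a <= b ->
  (forall x, a <= x <= b -> is_derive f x (df x)) ->
  (forall x, a <= x <= b -> 0 <= df x) ->
  f a <= f b.
Proof.
  intros Hab Hd Hpos.
  destruct (MVT_gen f a b df) as [c [Hc Heq]];
    rewrite ?Rmin_left, ?Rmax_right in * by exact Hab.
  - intros x Hx. apply Hd. lra.
  - intros x Hx.
    apply continuity_pt_filterlim, (ex_derive_continuous f).
    exists (df x). exact (Hd x Hx).
  - pose proof (Rmult_le_pos (df c) (b - a) (Hpos c Hc) ltac:(lra)). lra.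
Qed.

(** Comparison with [c ln x], which tends to minus infinity at 0. *)
Lemma nonneg_derive_not_above_inverse (u du : R -> R) (c x0 : R) :
  0 < c -> 0 < x0 ->
  (forall x, 0 < x -> 0 <= u x) ->
  (forall x, 0 < x -> is_derive u x (du x)) ->
  ~ (forall x, 0 < x <= x0 -> c / x <= du x).
Proof.
  intros Hc Hx0 Hu Hd Hlow.
  (* Solution of [u x0 + c (ln t - ln x0) = - c]. *)
  set (t := exp (ln x0 - u x0 / c - 1)).
  assert (Ht : 0 < t) by apply exp_pos.
  pose proof (Hu x0 Hx0) as Hux0.
  assert (Hq : 0 <= u x0 / c).
  { apply Rmult_le_pos; [exact Hux0|].
    left. apply Rinv_0_lt_compat. exact Hc. }
  assert (Htx : t <= x0).
  { apply Rle_trans with (exp (ln x0)).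
    - left. apply exp_increasing. lra.
    - right. exact (exp_ln x0 Hx0). }
  assert (Hmon : u t - c * ln t <= u x0 - c * ln x0).
  { apply (nondecreasing_of_derive_nonneg
             (fun x => u x - c * ln x) (fun x => du x - c * / x) t x0 Htx).
    - intros x Hx.
      apply (is_derive_minus u (fun x => c * ln x)).
      + apply Hd. lra.
      + apply (is_derive_scal ln). apply is_derive_ln. lra.
    - intros x Hx.
      pose proof (Hlow x ltac:(lra)) as Hl. unfold Rdiv in Hl. lra. }
  pose proof (Hu t Ht) as Hut.
  unfold t in Hmon at 2. rewrite ln_exp in Hmon.
  replace (c * (ln x0 - u x0 / c - 1)) with (c * ln x0 - u x0 - c) in Hmon
    by (field; lra).
  lra.
Qed.

(** The inductive step for the signs: a nondecreasing [v] that is negative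
    somewhere stays below some [- c < 0] near 0, which forces [u' >= c / x]. *)
Lemma nonneg_of_euler_relation (k : R) (u v : R -> R) :
  0 <= k ->
  (forall x, 0 < x -> 0 <= u x) ->
  (forall x, 0 < x -> is_derive u x ((k * u x - v x) / x)) ->
  (forall x y, 0 < x -> x <= y -> v x <= v y) ->
  forall x, 0 < x -> 0 <= v x.
Proof.
  intros Hk Hu Hd Hmon x0 Hx0.
  apply Rnot_lt_le. intros Hneg.
  apply (nonneg_derive_not_above_inverse
           u (fun x => (k * u x - v x) / x) (- v x0) x0); try assumption.
  - lra.
  - intros x Hx.
    apply Rmult_le_compat_r.
    + left. apply Rinv_0_lt_compat. lra.
    + pose proof (Hmon x x0 ltac:(lra) ltac:(lra)).
      pose proof (Rmult_le_pos k (u x) Hk (Hu x ltac:(lra))). lra.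
Qed.

(** * Dividing a generalized Bernstein function by its power *)

Lemma is_derive_Rpower (a x : R) :
  0 < x -> is_derive (fun y => Rpower y a) x (a * Rpower x a / x).
Proof.
  intros Hx.
  replace (a * Rpower x a / x) with (a * Rpower x (a - 1)).
  - apply is_derive_Reals. apply derivable_pt_lim_power. exact Hx.
  - unfold Rminus.
    rewrite Rpower_plus, Rpower_Ropp, (Rpower_1 x Hx). field. lra.
Qed.

(** Solving [x h^(n+1) + (n+l) h^(n) = g^(n)] for the next derivative. *)
Fixpoint euler_tower (l : R) (G : nat -> R -> R) (h : R -> R)
    (n : nat) (x : R) : R :=
  match n with
  | O => h x
  | S m => (G m x - (INR m + l) * euler_tower l G h m x) / x
  end.

Lemma euler_tower_correct (l : R) (G : nat -> R -> R) (h : R -> R) :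
  derivative_tower G ->
  (forall x, 0 < x -> is_derive h x ((G 0%nat x - l * h x) / x)) ->
  derivative_tower (euler_tower l G h).
Proof.
  intros HG Hh n.
  induction n as [|n IH]; intros x Hx.
  - simpl euler_tower. rewrite Rplus_0_l. exact (Hh x Hx).
  - specialize (IH x Hx). pose proof (HG n x Hx) as HGn.
    set (e := euler_tower l G h n) in *.
    set (e' := euler_tower l G h (S n) x) in *.
    change (is_derive (fun y => (G n y - (INR n + l) * e y) / y) x
              ((G (S n) x - (INR (S n) + l) * e') / x)).
    assert (He' : e' = (G n x - (INR n + l) * e x) / x) by reflexivity.
    clearbody e'.
    evar_last.
    + apply (is_derive_div (fun y => G n y - (INR n + l) * e y) (fun y => y)).
      * apply (is_derive_minus (G n) (fun y => (INR n + l) * e y)).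
        -- exact HGn.
        -- apply is_derive_scal. exact IH.
      * apply (is_derive_id x).
      * lra.
    + rewrite S_INR.
      unfold minus, plus, opp, one; simpl.
      rewrite He'.
      field. lra.
Qed.

(** The power of [x] is the integrating factor of the [n] times differentiated
    Euler equation, and the sign makes its derivative nonnegative. *)
Definition scaled_derivative (l : R) (H : nat -> R -> R) (n : nat) (x : R) : R :=
  Rpower x (INR n + l) * ((-1) ^ n * H n x).

Lemma is_derive_scaled_derivative (l : R) (H : nat -> R -> R) (n : nat) (x : R) :
  derivative_tower H -> 0 < x ->
  is_derive (scaled_derivative l H n) x
    (((INR n + l) * scaled_derivative l H n x
      - scaled_derivative l H (S n) x) / x).
Proof.
  intros HH Hx.
  unfold scaled_derivative.
  evar_last.
  - apply (is_derive_mult (fun y => Rpower y (INR n + l))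
             (fun y => (-1) ^ n * H n y)).
    + exact (is_derive_Rpower _ x Hx).
    + apply is_derive_scal. exact (HH n x Hx).
    + exact Rmult_comm.
  - rewrite S_INR.
    replace (INR n + 1 + l) with (INR n + l + 1) by ring.
    rewrite (Rpower_plus (INR n + l) 1), (Rpower_1 x Hx).
    unfold plus, mult; simpl. field. lra.
Qed.

Lemma euler_solution_completely_monotonic (l : R) (g h : R -> R) :
  0 <= l ->
  completely_monotonic g ->
  (forall x, 0 < x -> 0 <= h x) ->
  (forall x, 0 < x -> is_derive h x ((g x - l * h x) / x)) ->
  completely_monotonic h.
Proof.
  intros Hl [Hg Sg] Hh Hd.
  set (H := euler_tower l (Derive_n g) h).
  assert (HH : derivative_tower H)
    by exact (euler_tower_correct l _ h (smooth_tower g Hg) Hd).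
  assert (Hmon : forall n x y, 0 < x -> x <= y ->
            scaled_derivative l H n x <= scaled_derivative l H n y).
  { intros n x y Hx Hxy.
    apply (nondecreasing_of_derive_nonneg _ _ x y Hxy
             (fun z Hz => is_derive_scaled_derivative l H n z HH ltac:(lra))).
    intros z Hz.
    assert (Hz0 : 0 < z) by lra.
    (* By the Euler equation only the [g^(n)] term survives. *)
    replace (((INR n + l) * scaled_derivative l H n z
              - scaled_derivative l H (S n) z) / z)
      with (Rpower z (INR n + l) * ((-1) ^ n * Derive_n g n z) * / z).
    - apply Rmult_le_pos.
      + apply Rmult_le_pos; [left; apply exp_pos|exact (Sg n z Hz0)].
      + left. apply Rinv_0_lt_compat. exact Hz0.
    - unfold scaled_derivative.
      change (H (S n) z)
        with ((Derive_n g n z - (INR n + l) * H n z) / z).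
      rewrite S_INR.
      replace (INR n + 1 + l) with (INR n + l + 1) by ring.
      rewrite (Rpower_plus (INR n + l) 1), (Rpower_1 z Hz0).
      simpl. field. lra. }
  assert (Hpos : forall n x, 0 < x -> 0 <= scaled_derivative l H n x).
  { intros n. induction n as [|n IH].
    - intros x Hx. unfold scaled_derivative.
      apply Rmult_le_pos; [left; apply exp_pos|].
      rewrite pow_O, Rmult_1_l. exact (Hh x Hx).
    - apply (nonneg_of_euler_relation (INR n + l) (scaled_derivative l H n)).
      + pose proof (pos_INR n). lra.
      + exact IH.
      + intros x Hx. exact (is_derive_scaled_derivative l H n x HH Hx).
      + exact (Hmon (S n)). }
  apply (completely_monotonic_of_tower h H HH).
  - reflexivity.
  - intros n x Hx.
    apply Rmult_le_reg_l with (Rpower x (INR n + l)); [apply exp_pos|].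
    rewrite Rmult_0_r. exact (Hpos n x Hx).
Qed.

Lemma gen_bernstein_div_power (l : R) (f : R -> R) :
  0 <= l -> gen_bernstein l f ->
  completely_monotonic (fun x => Rpower x (- l) * f x).
Proof.
  intros Hl [Hf [Hpos Hg]].
  apply (euler_solution_completely_monotonic l
           (fun x => Rpower x (1 - l) * Derive f x)); try assumption.
  - intros x Hx. left.
    apply Rmult_lt_0_compat; [apply exp_pos|exact (Hpos x Hx)].
  - intros x Hx.
    evar_last.
    + apply (is_derive_mult (fun y => Rpower y (- l)) f).
      * exact (is_derive_Rpower _ x Hx).
      * exact (smooth_is_derive f x Hf Hx).
      * exact Rmult_comm.
    + unfold Rminus at 2. rewrite Rpower_plus, (Rpower_1 x Hx).
      unfold plus, mult; simpl. field. lra.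
Qed.

(** * Products of generalized Bernstein functions *)

Theorem proposition5p1 (lambda1 lambda2 : R) (f1 f2 : R -> R)
  (hlambda1 : 0 < lambda1) (hlambda2 : 0 < lambda2)
  (hf1 : gen_bernstein lambda1 f1) (hf2 : gen_bernstein lambda2 f2) :
  gen_bernstein (lambda1 + lambda2) (fun x => f1 x * f2 x).
Proof.
  assert (hh1 := gen_bernstein_div_power _ _ (Rlt_le _ _ hlambda1) hf1).
  assert (hh2 := gen_bernstein_div_power _ _ (Rlt_le _ _ hlambda2) hf2).
  destruct hf1 as [Hf1 [Hpos1 Hg1]].
  destruct hf2 as [Hf2 [Hpos2 Hg2]].
  split; [exact (smooth_mult f1 f2 Hf1 Hf2)|].
  split.
  { intros x Hx.
    apply Rmult_lt_0_compat; [exact (Hpos1 x Hx)|exact (Hpos2 x Hx)]. }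
  refine (completely_monotonic_ext _ _ _
            (completely_monotonic_plus _ _
               (completely_monotonic_mult _ _ Hg1 hh2)
               (completely_monotonic_mult _ _ hh1 Hg2))).
  intros x Hx.
  rewrite Derive_mult
    by (eexists; apply smooth_is_derive; assumption).
  replace (1 - (lambda1 + lambda2)) with (1 + - lambda1 + - lambda2) by ring.
  unfold Rminus.
  rewrite !Rpower_plus. ring.
Qed.
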